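(* Lie-Rinehart monoids in the symmetric monoidal category $s\mathcal{V}ec(\mathbb C)$ of complex super vector spaces are precisely Lie-Rinehart superalgebras.
   Context: $s\mathcal{V}ec(\mathbb C)$: objects are $\mathbb Z_2$-graded complex vector spaces, morphisms are grading-preserving (even) linear maps, the unit is $\mathbb C$ in degree $\bar 0$, and the braiding is $c_{V,W}(v\otimes w)=(-1)^{|v||w|}w\otimes v$. Associativity and unit constraints are suppressed. Lie-Rinehart monoid in a linear symmetric monoidal category $\mathcal C$ with braiding $c$: a tuple $(A,m,\eta,L,\mu,\alpha,\beta)$ where $(A,m,\eta)$ is a commutative associative unital monoid ($m\circ c_{A,A}=m$); $(L,\mu)$ is a Lie monoid, i.e. $\mu:L\otimes L\to L$ with $\mu=-\mu\circ c_{L,L}$ and $\mu\circ(\mathrm{id}_L\otimes\mu)=\mu\circ(\mu\otimes\mathrm{id}_L)+\mu\circ(\mathrm{id}_L\otimes\mu)\circ(c_{L,L}\otimes\mathrm{id}_L)$; $\beta:A\otimes L\to L$ is a left $A$-module structure; and $\alpha:L\otimes A\to A$ (the anchor) is a morphism such that (i) $\alpha\circ(\mathrm{id}_L\otimes m)=m\circ(\alpha\otimes\mathrm{id}_A)+m\circ(\mathrm{id}_A\otimes\alpha)\circ(c_{L,A}\otimes\mathrm{id}_A)$; (ii) $\alpha\circ(\beta\otimes\mathrm{id}_A)=m\circ(\mathrm{id}_A\otimes\alpha)$; (iii) $\alpha\circ(\mathrm{id}_L\otimes\alpha)=\alpha\circ(\mu\otimes\mathrm{id}_A)+\alpha\circ(\mathrm{id}_L\otimes\alpha)\circ(c_{L,L}\otimes\mathrm{id}_A)$;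 (iv) $\mu\circ(\mathrm{id}_L\otimes\beta)=\beta\circ(\alpha\otimes\mathrm{id}_L)+\beta\circ(\mathrm{id}_A\otimes\mu)\circ(c_{L,A}\otimes\mathrm{id}_L)$. Lie-Rinehart superalgebra: let $A$ be a unital associative supercommutative superalgebra over $\mathbb C$ (supercommutative: $ab=(-1)^{|a||b|}ba$). A superderivation of degree $|f|$ is a homogeneous linear map $f:A\to A$ with $f(ab)=f(a)b+(-1)^{|a||f|}af(b)$; $s\mathrm{Der}(A)=s\mathrm{Der}(A)_0\oplus s\mathrm{Der}(A)_1$, where $s\mathrm{Der}(A)_i$ is the space of superderivations of degree $i$, is a Lie superalgebra with bracket $[f,g]=f\circ g-(-1)^{|f||g|}g\circ f$, and an $A$-module via $(a\cdot f)(b)=af(b)$. A Lie-Rinehart superalgebra is a triple $(A,L,\tilde\alpha)$ with $L$ a Lie superalgebra equipped with a ($\mathbb Z_2$-graded) $A$-module structure and $\tilde\alpha:L\to s\mathrm{Der}(A)$ an even map which is simultaneously a homomorphism of Lie superalgebras and of $A$-modules, such that $[x,a\cdot y]=(-1)^{|a||x|}a\cdot[x,y]+\tilde\alpha(x)(a)\cdot y$ for all (homogeneous) $x,y\in L$, $a\in A$. *)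

(* Defs.v *)
From HB Require Import structures.
From mathcomp Require Import all_boot all_order all_algebra.
From mathcomp Require Import generic_quotient.
From mathcomp Require Import boolp classical_sets functions reals complex.
From mathcomp Require Import freeg.

Set Implicit Arguments.
Unset Strict Implicit.
Unset Printing Implicit Defensive.

Import GRing.Theory.
Local Open Scope ring_scope.
Local Open Scope classical_set_scope.
Local Open Scope quotient_scope.

Section Subspaces.
Variables (K : fieldType) (M : lmodType K).

Definition subspace (S : set M) : Prop :=
  S 0 /\ forall (a : K) (u v : M), S u -> S v -> S (a *: u + v).

Definition span_set (X : set M) : set M :=
  [set v | forall S : set M, subspace S -> X `<=` S -> S v].

Lemma span_subspace (X : set M) : subspace (span_set X).
Proof.
split=> [S [] // | a u v Xu Xv S hS XS].
by case: (hS) => _; apply; [apply: Xu | apply: Xv].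
Qed.

Lemma sub_span (X : set M) : X `<=` span_set X.
Proof. by move=> x Xx S _; apply. Qed.

Lemma subspaceD (S : set M) u v : subspace S -> S u -> S v -> S (u + v).
Proof. by case=> _ h Su Sv; rewrite -[u]scale1r; apply: h. Qed.

Lemma subspaceZ (S : set M) a u : subspace S -> S u -> S (a *: u).
Proof. by case=> S0 h Su; rewrite -[_ *: _]addr0; apply: h. Qed.

Lemma subspaceN (S : set M) u : subspace S -> S u -> S (- u).
Proof. by move=> h Su; rewrite -scaleN1r; apply: subspaceZ. Qed.

Lemma subspaceB (S : set M) u v : subspace S -> S u -> S v -> S (u - v).
Proof. by move=> h Su Sv; apply: subspaceD => //; apply: subspaceN. Qed.

End Subspaces.

Section LinearMaps.
Variables (K : fieldType) (M : lmodType K).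

Lemma subspace_eq (U : lmodType K) (f g : M -> U) :
  linear f -> linear g -> subspace [set v | f v = g v].
Proof.
move=> hf hg; split=> [|a u v /= fu fv]; last by rewrite hf hg fu fv.
have f0 (h : M -> U) : linear h -> h 0 = 0.
  by move=> hh; have := hh (-1) 0 0; rewrite scaler0 addr0 scaleN1r addNr.
by rewrite /= !f0.
Qed.

Lemma subspace_preim (U : lmodType K) (f : M -> U) (S : set U) :
  linear f -> subspace S -> subspace [set v | S (f v)].
Proof.
move=> hf [S0 hS]; split=> [|a u v /= Su Sv]; last by rewrite hf; apply: hS.
by have := hf (-1) 0 0; rewrite scaler0 addr0 scaleN1r addNr /= => ->.
Qed.

Lemma linear_fun0 (U : lmodType K) (f : M -> U) : linear f -> f 0 = 0.
Proof. by move=> hf; have := hf (-1) 0 0; rewrite scaler0 addr0 scaleN1r addNr. Qed.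

Lemma linear_funD (U : lmodType K) (f : M -> U) u v :
  linear f -> f (u + v) = f u + f v.
Proof. by move=> hf; have := hf 1 u v; rewrite !scale1r. Qed.

Lemma linear_funZ (U : lmodType K) (f : M -> U) a u :
  linear f -> f (a *: u) = a *: f u.
Proof. by move=> hf; have := hf a u 0; rewrite (linear_fun0 hf) !addr0. Qed.

End LinearMaps.

Section QuotientModule.
Variables (K : fieldType) (M : lmodType K) (N : set M) (hN : subspace N).

Definition quot_rel : rel M := fun x y => `[< N (x - y) >].

Lemma quot_rel_equiv : equiv_class_of quot_rel.
Proof.
split=> [x|x y|y x z].
- by apply/asboolP; rewrite subrr; case: hN.
- by apply/asboolP/asboolP => /(subspaceN hN); rewrite opprB.
- move=> /asboolP h1 /asboolP h2; apply/asboolP.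
  by have := subspaceD hN h1 h2; rewrite addrA subrK.
Qed.

Canonical quot_equiv := EquivRelPack quot_rel_equiv.

Definition quot_mod := {eq_quot quot_equiv}.
HB.instance Definition _ := Choice.on quot_mod.
HB.instance Definition _ := EqQuotient.on quot_mod.

Definition quot_pi : M -> quot_mod := \pi_quot_mod.

Lemma quot_piE x y : quot_pi x = quot_pi y <-> N (x - y).
Proof.
split=> [/eqP|h]; first by rewrite /quot_pi eqmodE => /asboolP.
by apply/eqP; rewrite /quot_pi eqmodE; apply/asboolP.
Qed.

Lemma quot_reprK q : quot_pi (repr q) = q.
Proof. exact: reprK. Qed.

Lemma quot_ind (P : quot_mod -> Prop) : (forall x, P (quot_pi x)) -> forall q, P q.
Proof. by move=> h q; rewrite -[q]quot_reprK. Qed.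

Lemma quot_repr x : N (repr (quot_pi x) - x).
Proof. by apply/quot_piE; rewrite quot_reprK. Qed.

Definition quot_add (p q : quot_mod) := quot_pi (repr p + repr q).
Definition quot_opp (p : quot_mod) := quot_pi (- repr p).
Definition quot_scale (a : K) (p : quot_mod) := quot_pi (a *: repr p).

Lemma quot_addE x y : quot_add (quot_pi x) (quot_pi y) = quot_pi (x + y).
Proof.
apply/quot_piE; rewrite opprD addrACA.
by apply: subspaceD => //; apply: quot_repr.
Qed.

Lemma quot_oppE x : quot_opp (quot_pi x) = quot_pi (- x).
Proof. by apply/quot_piE; rewrite -opprD; apply: subspaceN => //; apply: quot_repr. Qed.

Lemma quot_scaleE a x : quot_scale a (quot_pi x) = quot_pi (a *: x).
Proof. by apply/quot_piE; rewrite -scalerBr; apply: subspaceZ => //; apply: quot_repr. Qed.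

Lemma quot_addA : associative quot_add.
Proof.
elim/quot_ind=> x; elim/quot_ind=> y; elim/quot_ind=> z.
by rewrite !quot_addE addrA.
Qed.
Lemma quot_addC : commutative quot_add.
Proof. by elim/quot_ind=> x; elim/quot_ind=> y; rewrite !quot_addE addrC. Qed.
Lemma quot_add0 : left_id (quot_pi 0) quot_add.
Proof. by elim/quot_ind=> x; rewrite !quot_addE add0r. Qed.
Lemma quot_addN : left_inverse (quot_pi 0) quot_opp quot_add.
Proof. by elim/quot_ind=> x; rewrite quot_oppE !quot_addE addNr. Qed.

HB.instance Definition _ :=
  GRing.isZmodule.Build quot_mod quot_addA quot_addC quot_add0 quot_addN.

Lemma quot_piD x y : quot_pi (x + y) = quot_pi x + quot_pi y.
Proof. by rewrite -quot_addE. Qed.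

Lemma quot_scaleA a b v : quot_scale a (quot_scale b v) = quot_scale (a * b) v.
Proof. by elim/quot_ind: v => x; rewrite !quot_scaleE scalerA. Qed.
Lemma quot_scale1 : left_id 1 quot_scale.
Proof. by elim/quot_ind=> x; rewrite !quot_scaleE scale1r. Qed.
Lemma quot_scaleDr : right_distributive quot_scale +%R.
Proof.
move=> a; elim/quot_ind=> x; elim/quot_ind=> y.
by rewrite -quot_piD !quot_scaleE -quot_piD scalerDr.
Qed.
Lemma quot_scaleDl v : {morph quot_scale^~ v : a b / a + b}.
Proof. by move=> a b; elim/quot_ind: v => x /=; rewrite !quot_scaleE -quot_piD scalerDl. Qed.

HB.instance Definition _ := GRing.Zmodule_isLmodule.Build K quot_mod
  quot_scaleA quot_scale1 quot_scaleDr quot_scaleDl.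

Lemma quot_pi_linear : linear quot_pi.
Proof. by move=> a x y; rewrite quot_piD -quot_scaleE. Qed.

Section Lift.
Variables (U : lmodType K) (f : M -> U).
Definition quot_lift (q : quot_mod) : U := f (repr q).
Hypotheses (hf : linear f) (f0 : forall x, N x -> f x = 0).

Lemma quot_liftE x : quot_lift (quot_pi x) = f x.
Proof.
have := f0 (quot_repr x); rewrite -scaleN1r addrC hf scaleN1r addrC.
by move/eqP; rewrite subr_eq0 => /eqP.
Qed.

Lemma quot_lift_linear : linear quot_lift.
Proof.
move=> a; elim/quot_ind=> x; elim/quot_ind=> y.
by rewrite -quot_pi_linear !quot_liftE hf.
Qed.
End Lift.

End QuotientModule.

Section TensorProduct.
Variable K : fieldType.
Implicit Types U V W : lmodType K.

Definition bilinear_map V W U (f : V -> W -> U) : Prop :=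
  (forall v, linear (f v)) /\ (forall w, linear (f^~ w)).

(* The tensor product is the quotient of the free module on V * W by the
   span of the bilinearity relators. *)
Definition tensor_relators V W : set {freeg (V * W) / K} :=
  [set t | (exists (a : K) (v v' : V) (w : W),
              t = << 1 *g (a *: v + v', w) >>
                  - (a *: << 1 *g (v, w) >> + << 1 *g (v', w) >>))
        \/ (exists (a : K) (v : V) (w w' : W),
              t = << 1 *g (v, a *: w + w') >>
                  - (a *: << 1 *g (v, w) >> + << 1 *g (v, w') >>))].

Definition tensor V W : lmodType K :=
  quot_mod (span_subspace (@tensor_relators V W)).

Definition tens V W (v : V) (w : W) : tensor V W :=
  quot_pi (span_subspace (@tensor_relators V W)) << 1 *g (v, w) >>.

Lemma tens_bilinear V W : bilinear_map (@tens V W).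
Proof.
split=> [v|w] a x y; rewrite -quot_pi_linear; apply/quot_piE; apply: sub_span.
- by right; exists a, v, x, y.
- by left; exists a, x, y, w.
Qed.

Lemma fglift_linear V W U (f : V * W -> U) :
  linear (fglift f : {freeg (V * W) / K} -> U).
Proof.
have hB : {morph fglift f : x y / x - y} by exact: lift_is_additive.
have h0 : fglift f 0 = 0 by have := hB 0 0; rewrite !subrr.
have hD : {morph fglift f : x y / x + y}.
  move=> x y; have hN z : fglift f (- z) = - fglift f z.
    by rewrite -sub0r hB h0 sub0r.
  by rewrite -[y in x + y]opprK hB hN opprK.
have hs (I : Type) (s : seq I) (F : I -> {freeg (V * W) / K}) :
    fglift f (\sum_(i <- s) F i) = \sum_(i <- s) fglift f (F i).
  by elim/big_rec2: _ => // i ? ? _ <-; rewrite hD.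
move=> a x y; rewrite hD; congr (_ + _).
rewrite -[x]freeg_sumE scaler_sumr !hs scaler_sumr; apply: eq_bigr => i _.
suff -> : a *: << coeff i x *g i >> = << a * coeff i x *g i >> :> {freeg (V * W) / K}.
  by rewrite !liftU scalerA.
by apply/eqP/freeg_eqP => z; rewrite coeffZ !coeffU mulrA.
Qed.

Lemma tensor_ind V W (P : set (tensor V W)) :
  subspace P -> (forall v w, P (tens v w)) -> forall t, P t.
Proof.
move=> hP ht; elim/quot_ind => x; rewrite -[x]freeg_sumE.
apply: (@big_ind _ (fun x => P (quot_pi _ x))).
- by rewrite (linear_fun0 (quot_pi_linear _)); case: hP.
- by move=> y z Py Pz; rewrite quot_piD; apply: subspaceD.
move=> [v w] _.
have -> : << coeff (v, w) x *g (v, w) >> =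
          coeff (v, w) x *: << 1 *g (v, w) >> :> {freeg (V * W) / K}.
  by apply/eqP/freeg_eqP => z; rewrite coeffZ !coeffU mul1r.
by rewrite (linear_funZ _ _ (quot_pi_linear _)); apply: subspaceZ => //; apply: ht.
Qed.

Section TensorLift.
Variables (V W U : lmodType K) (f : V -> W -> U).
Definition tensor_lift : tensor V W -> U :=
  quot_lift (fglift (fun p : V * W => f p.1 p.2)).
Hypothesis hf : bilinear_map f.

Lemma tensor_lift0 x : span_set (@tensor_relators V W) x ->
  fglift (fun p : V * W => f p.1 p.2) x = 0.
Proof.
set g := fglift _; have gl : linear g by exact: fglift_linear.
have gB y z : g (y - z) = g y - g z.
  by rewrite (linear_funD _ _ gl) -!scaleN1r (linear_funZ _ _ gl).
move=> /(_ [set x | g x = 0]); apply.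
  split=> [|a u v /= gu gv]; first exact: linear_fun0.
  by rewrite gl gu gv scaler0 addr0.
case: hf => h1 h2 y [] [a [v [v' [w ->]]]] /=.
- by rewrite gB gl /g !liftU /= !scale1r h2 subrr.
- by rewrite gB gl /g !liftU /= !scale1r h1 subrr.
Qed.

Lemma tensor_liftE v w : tensor_lift (tens v w) = f v w.
Proof.
rewrite /tensor_lift quot_liftE ?liftU ?scale1r //.
- exact: fglift_linear.
- exact: tensor_lift0.
Qed.

Lemma tensor_lift_linear : linear tensor_lift.
Proof. apply: quot_lift_linear; [exact: fglift_linear | exact: tensor_lift0]. Qed.
End TensorLift.

End TensorProduct.

(* Degrees in Z/2 are booleans (false is even): addition of degrees is addb,
   written (+), and the sign (-1)^(ij) is (-1) ^+ (i && j). *)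
Record superSpace (K : fieldType) := SuperSpace {
  super_sort :> lmodType K;
  part : bool -> set super_sort;
  part_subspace : forall i, subspace (part i);
  part_decomp : forall v, exists! p : super_sort * super_sort,
    [/\ part false p.1, part true p.2 & v = p.1 + p.2] }.

Arguments part {K} V i : rename.

Section SuperSpaceTheory.
Variable K : fieldType.
Implicit Types V W U X : superSpace K.

Lemma decomp_unique (M : lmodType K) (P : bool -> set M) :
  (forall i, subspace (P i)) ->
  (forall v, exists p : M * M, [/\ P false p.1, P true p.2 & v = p.1 + p.2]) ->
  (forall v, P false v -> P true v -> v = 0) ->
  forall v, exists! p : M * M, [/\ P false p.1, P true p.2 & v = p.1 + p.2].
Proof.
move=> hP ex dis v; have [p [p0 p1 pv]] := ex v; exists p; split=> //.
move=> [a b] [/= a0 b1 av]; have e : p.1 - a = b - p.2.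
  by apply/eqP; rewrite subr_eq addrAC eq_sym subr_eq -pv av addrC.
have z : p.1 - a = 0.
  by apply: dis; [|rewrite e]; apply: subspaceB.
move: (e); rewrite z => /esym/eqP; rewrite subr_eq0 => /eqP ->.
by move/eqP: z; rewrite subr_eq0 => /eqP <-; case: (p).
Qed.

Definition comps V (v : V) : V * V := sval (cid (part_decomp v)).
Definition proj V (i : bool) (v : V) : V := if i then (comps v).2 else (comps v).1.
Arguments proj : simpl never.

Lemma compsP V (v : V) :
  [/\ part V false (proj false v), part V true (proj true v)
    & v = proj false v + proj true v].
Proof. by rewrite /proj /comps; case: cid => p []. Qed.

Lemma proj_part V i (v : V) : part V i (proj i v).
Proof. by case: (compsP v); case: i. Qed.

Lemma proj_sum V (v : V) : v = proj false v + proj true v.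
Proof. by case: (compsP v). Qed.

Lemma part0 V i : part V i 0.
Proof. by case: (part_subspace V i). Qed.

Lemma proj_unique V (v a b : V) :
  part V false a -> part V true b -> v = a + b ->
  proj false v = a /\ proj true v = b.
Proof.
move=> ha hb e; rewrite /proj /comps; case: cid => p [_ /= /(_ (a, b))] h.
by rewrite h.
Qed.

Lemma projE V i j (v : V) : part V i v -> proj j v = if i == j then v else 0.
Proof.
have z k : part V k 0 by exact: part0.
case: i => hv.
- by have [h0 h1] := proj_unique (z _) hv (esym (add0r v)); case: j.
- by have [h0 h1] := proj_unique hv (z _) (esym (addr0 v)); case: j.
Qed.

Lemma proj_linear V i : linear (@proj V i).
Proof.
move=> a u v; have h k : part V k (a *: proj k u + proj k v).
  by case: (part_subspace V k) => _; apply; apply: proj_part.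
have e : a *: u + v = (a *: proj false u + proj false v)
                    + (a *: proj true u + proj true v).
  by rewrite addrACA -scalerDr -!proj_sum.
by have [? ?] := proj_unique (h _) (h _) e; case: i.
Qed.

Definition even_linear V W : {pred V -> W} :=
  fun f => `[< linear f /\ forall i v, part V i v -> part W i (f v) >].

Record shom V W := Shom { shom_fun :> V -> W; _ : shom_fun \in @even_linear V W }.

Lemma even_linear_closed V W : submod_closed (@even_linear V W).
Proof.
split.
  by apply/asboolP; split=> [a u v|i v _]; [rewrite scaler0 addr0 | exact: part0].
move=> a f g /asboolP [fl fe] /asboolP [gl ge]; apply/asboolP; split.
  move=> b u v; rewrite /= !fctE /=.
  by rewrite fl gl !scalerDr !scalerA mulrC addrACA.
move=> i v hv; case: (part_subspace W i) => _; apply; [exact: fe | exact: ge].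
Qed.

HB.instance Definition _ V W := GRing.isSubmodClosed.Build K (V -> W)
  (@even_linear V W) (GRing.submod_closed_semi (@even_linear_closed V W)).
HB.instance Definition _ V W := [isSub for @shom_fun V W].
HB.instance Definition _ V W := [Choice of shom V W by <:].
HB.instance Definition _ V W := [SubChoice_isSubLmodule of shom V W by <:].

Lemma shom_linear V W (f : shom V W) : linear f.
Proof. by case: f => f /= /asboolP[]. Qed.

Lemma shom_part V W (f : shom V W) i v : part V i v -> part W i (f v).
Proof. by case: f => f /= /asboolP[_]; apply. Qed.

Lemma shomP V W (f g : shom V W) : f =1 g -> f = g.
Proof. by move=> e; apply: val_inj; apply: funext. Qed.

Lemma shomDE V W (f g : shom V W) v : (f + g) v = f v + g v.
Proof. by []. Qed.
Lemma shomZE V W a (f : shom V W) v : (a *: f) v = a *: f v.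
Proof. by []. Qed.

Definition mk_shom V W (f : V -> W) (fl : linear f)
  (fe : forall i v, part V i v -> part W i (f v)) : shom V W :=
  @Shom V W f (introT (asboolP _) (conj fl fe)).

Definition sid V : shom V V :=
  @mk_shom V V id (fun a u v => erefl) (fun i v h => h).

Lemma scomp_linear U V W (g : shom V W) (f : shom U V) : linear (fun u => g (f u)).
Proof. by move=> a u v; rewrite !shom_linear. Qed.
Definition scomp U V W (g : shom V W) (f : shom U V) : shom U W :=
  mk_shom (scomp_linear g f) (fun i u h => shom_part g (shom_part f h)).

Lemma ground_decomp (v : K^o) : exists! p : K^o * K^o,
  [/\ True, p.2 = 0 & v = p.1 + p.2].
Proof.
exists (v, 0); split=> [|[a b] [_ /= -> ->]]; last by rewrite addr0.
by split; rewrite //= addr0.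
Qed.

Lemma ground_subspace i : subspace (if i then [set 0] else setT : set K^o).
Proof. by case: i; split=> //= a u v -> ->; rewrite scaler0 addr0. Qed.

Definition sunit : superSpace K :=
  @SuperSpace K K^o _ ground_subspace ground_decomp.

Lemma lin_ext1 V (U : lmodType K) (f g : V -> U) : linear f -> linear g ->
  (forall i v, part V i v -> f v = g v) -> f =1 g.
Proof.
move=> fl gl h v; rewrite [v]proj_sum !(linear_funD _ _ fl) !(linear_funD _ _ gl).
by rewrite !(h _ _ (proj_part _ _)).
Qed.

Section Tensor.
Variables V W : superSpace K.

Definition tensor_part (k : bool) : set (tensor V W) :=
  span_set [set t | exists i v w,
    [/\ part V i v, part W (k (+) i) w & t = tens v w]].

Lemma tensor_part_subspace k : subspace (tensor_part k).
Proof. exact: span_subspace. Qed.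

Lemma tens_part i j v w : part V i v -> part W j w -> tensor_part (i (+) j) (tens v w).
Proof.
by move=> hv hw; apply: sub_span; exists i, v, w; split; rewrite // addbAC addbb.
Qed.

Lemma tensor_part_ind k (S : set (tensor V W)) : subspace S ->
  (forall i j v w, part V i v -> part W j w -> k = i (+) j -> S (tens v w)) ->
  forall t, tensor_part k t -> S t.
Proof.
move=> hS h t /(_ S hS); apply=> _ [i [v [w [hv hw ->]]]].
by apply: h hv hw _; rewrite addbC -addbA addbb addbF.
Qed.

Definition tensor_proj k : tensor V W -> tensor V W :=
  tensor_lift (fun v w => \sum_(i : bool) tens (proj i v) (proj (k (+) i) w)).

Lemma lin_sum (M U : lmodType K) (F : bool -> M -> U) :
  (forall i, linear (F i)) -> linear (fun x => \sum_i F i x).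
Proof.
move=> h a x y; rewrite scaler_sumr -big_split /=.
by apply: eq_bigr => i _; rewrite h.
Qed.

Lemma tensor_proj_bilinear k :
  bilinear_map (fun v w => \sum_(i : bool) tens (proj i v : V) (proj (k (+) i) w : W)).
Proof.
have [tl tr] := tens_bilinear V W.
split=> [v|w]; apply: lin_sum => i a x y; rewrite proj_linear; [exact: tl|exact: tr].
Qed.

Lemma tensor_projE k l t : tensor_part k t -> tensor_proj l t = if k == l then t else 0.
Proof.
have [tl tr] := tens_bilinear V W.
have pl := tensor_lift_linear (tensor_proj_bilinear l).
have il : linear (fun t : tensor V W => if k == l then t else 0).
  by case: eqP => _ a u v //; rewrite scaler0 addr0.
apply: (@tensor_part_ind _ [set t | tensor_proj l t = if k == l then t else 0]).
  exact: subspace_eq.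
move=> i j v w hv hw ->; rewrite /= /tensor_proj tensor_liftE; last exact: tensor_proj_bilinear.
rewrite big_bool /= !(projE _ hv) !(projE _ hw).
have t0 x : tens x 0 = 0 :> tensor V W by exact: linear_fun0 (tl x).
have t0' x : tens 0 x = 0 :> tensor V W by exact: linear_fun0 (tr x).
by case: i {hv}; case: j {hw}; case: l {pl il}; rewrite /= ?t0 ?t0' ?addr0 ?add0r.
Qed.

Lemma tensor_part_decomp t : exists! p : tensor V W * tensor V W,
  [/\ tensor_part false p.1, tensor_part true p.2 & t = p.1 + p.2].
Proof.
have hP := tensor_part_subspace.
apply: (decomp_unique hP) => {t} [|t h0 h1]; last first.
  by have := tensor_projE false h0; rewrite (tensor_projE false h1) /= => ->.
apply: tensor_ind.
  split=> [|a u v /= [p [p0 p1 ->]] [q [q0 q1 ->]]].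
    by exists (0, 0); split; rewrite /= ?addr0 //; [case: (hP false) | case: (hP true)].
  exists (a *: p.1 + q.1, a *: p.2 + q.2); split=> /=.
  - by case: (hP false) => _; apply.
  - by case: (hP true) => _; apply.
  - by rewrite scalerDr addrACA.
have [tl tr] := tens_bilinear V W.
move=> v w; exists (tens (proj false v) (proj false w) + tens (proj true v) (proj true w),
                    tens (proj false v) (proj true w) + tens (proj true v) (proj false w)).
have tp i j : tensor_part (i (+) j) (tens (proj i v) (proj j w)).
  by apply: tens_part; apply: proj_part.
split=> /=; [apply: (subspaceD (hP _)) (tp false false) (tp true true) |
             apply: (subspaceD (hP _)) (tp false true) (tp true false) |].
rewrite {1}[v]proj_sum {1}[w]proj_sum (linear_funD _ _ (tr _)) !(linear_funD _ _ (tl _)).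
by rewrite [X in _ + X = _]addrC addrACA.
Qed.

Definition stensor : superSpace K :=
  @SuperSpace K (tensor V W) tensor_part tensor_part_subspace tensor_part_decomp.

End Tensor.

Lemma lin_ext2 V W (U : lmodType K) (f g : stensor V W -> U) : linear f -> linear g ->
  (forall i j v w, part V i v -> part W j w -> f (tens v w) = g (tens v w)) -> f =1 g.
Proof.
move=> fl gl h; have [tl tr] := tens_bilinear V W.
apply: tensor_ind; first exact: subspace_eq.
have cl (M : lmodType K) (e : stensor V W -> U) (c : M -> stensor V W) :
  linear e -> linear c -> linear (fun x => e (c x)) by move=> el cl a x y; rewrite cl el.
move=> v w /=; move: v; apply: lin_ext1; [exact: cl (tr w)|exact: cl (tr w)|].
by move=> i v hv; move: w; apply: lin_ext1; [exact: cl (tl v)|exact: cl (tl v)|eauto].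
Qed.

Lemma comp_linear (M N U : lmodType K) (g : N -> U) (f : M -> N) :
  linear g -> linear f -> linear (fun x => g (f x)).
Proof. by move=> gl fl a x y; rewrite fl gl. Qed.

Lemma tensl (V W : lmodType K) (v : V) : linear (tens v : W -> tensor V W).
Proof. by case: (tens_bilinear V W). Qed.
Lemma tensr (V W : lmodType K) (w : W) : linear ((tens (W := W))^~ w : V -> tensor V W).
Proof. by case: (tens_bilinear V W). Qed.

Lemma shom_ext2 V W U (f g : shom (stensor V W) U) :
  (forall i j v w, part V i v -> part W j w -> f (tens v w) = g (tens v w)) -> f = g.
Proof. by move=> h; apply: shomP; apply: lin_ext2; [exact: (shom_linear f)|exact: (shom_linear g)|exact: h]. Qed.

Lemma lin_ext3l V W U (X : lmodType K) (f g : stensor (stensor V W) U -> X) :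
  linear f -> linear g ->
  (forall i j k v w u, part V i v -> part W j w -> part U k u ->
     f (tens (tens v w : stensor V W) u) = g (tens (tens v w : stensor V W) u)) ->
  f =1 g.
Proof.
move=> fl gl h; apply: lin_ext2 => // i k t u _ hu; move: t.
by apply: lin_ext2; [exact: comp_linear fl (@tensr _ _ u)|exact: comp_linear gl (@tensr _ _ u)|eauto].
Qed.

Lemma lin_ext3r V W U (X : lmodType K) (f g : stensor V (stensor W U) -> X) :
  linear f -> linear g ->
  (forall i j k v w u, part V i v -> part W j w -> part U k u ->
     f (tens v (tens w u : stensor W U)) = g (tens v (tens w u : stensor W U))) ->
  f =1 g.
Proof.
move=> fl gl h; apply: lin_ext2 => // i k v t hv _; move: t.
by apply: lin_ext2; [exact: comp_linear fl (@tensl _ _ v)|exact: comp_linear gl (@tensl _ _ v)|eauto].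
Qed.

Lemma shom_ext3l V W U X (f g : shom (stensor (stensor V W) U) X) :
  (forall i j k v w u, part V i v -> part W j w -> part U k u ->
     f (tens (tens v w : stensor V W) u) = g (tens (tens v w : stensor V W) u)) ->
  f = g.
Proof. by move=> h; apply: shomP; apply: lin_ext3l; [exact: (shom_linear f)|exact: (shom_linear g)|exact: h]. Qed.

Lemma shom_ext3r V W U X (f g : shom (stensor V (stensor W U)) X) :
  (forall i j k v w u, part V i v -> part W j w -> part U k u ->
     f (tens v (tens w u : stensor W U)) = g (tens v (tens w u : stensor W U))) ->
  f = g.
Proof. by move=> h; apply: shomP; apply: lin_ext3r; [exact: (shom_linear f)|exact: (shom_linear g)|exact: h]. Qed.

Lemma shom_ext4 V W U X Y (f g : shom (stensor (stensor (stensor V W) U) X) Y) :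
  (forall v w u x,
     f (tens (tens (tens v w : stensor V W) u : stensor (stensor V W) U) x) =
     g (tens (tens (tens v w : stensor V W) u : stensor (stensor V W) U) x)) ->
  f = g.
Proof.
move=> h; apply: shomP; apply: lin_ext2; try exact: shom_linear.
move=> i k t x _ hx; move: t; apply: lin_ext3l => //.
- exact: comp_linear (shom_linear f) (@tensr _ _ x).
- exact: comp_linear (shom_linear g) (@tensr _ _ x).
Qed.

Section Lift.
Variables (V W U : superSpace K) (f : V -> W -> U).
Hypotheses (hf : bilinear_map f)
  (fe : forall i j v w, part V i v -> part W j w -> part U (i (+) j) (f v w)).

Lemma slift_part i t : part (stensor V W) i t -> part U i (tensor_lift f t).
Proof.
apply: (@tensor_part_ind _ _ _ [set t | part U i (tensor_lift f t)]).
  by apply: subspace_preim; [exact: tensor_lift_linear | exact: part_subspace].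
by move=> j k v w hv hw -> /=; rewrite tensor_liftE //; apply: fe.
Qed.

Definition slift : shom (stensor V W) U :=
  @mk_shom (stensor V W) U _ (tensor_lift_linear hf) slift_part.

Lemma sliftE v w : slift (tens v w) = f v w.
Proof. exact: tensor_liftE. Qed.
End Lift.

End SuperSpaceTheory.

Record linSymMonCat (K : fieldType) := LinSymMonCat {
  ob :> Type;
  hom : ob -> ob -> lmodType K;
  idc : forall X, hom X X;
  comp : forall {X Y Z}, hom Y Z -> hom X Y -> hom X Z;
  tob : ob -> ob -> ob;
  thom : forall {X X' Y Y'},
    hom X X' -> hom Y Y' -> hom (tob X Y) (tob X' Y');
  unit_ob : ob;
  assoc : forall X Y Z, hom (tob (tob X Y) Z) (tob X (tob Y Z));
  assoc_inv : forall X Y Z, hom (tob X (tob Y Z)) (tob (tob X Y) Z);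
  lunit : forall X, hom (tob unit_ob X) X;
  lunit_inv : forall X, hom X (tob unit_ob X);
  runit : forall X, hom (tob X unit_ob) X;
  runit_inv : forall X, hom X (tob X unit_ob);
  braid : forall X Y, hom (tob X Y) (tob Y X);
  comp_idl : forall X Y (f : hom X Y), comp (idc Y) f = f;
  comp_idr : forall X Y (f : hom X Y), comp f (idc X) = f;
  comp_assoc : forall X Y Z T (h : hom Z T) (g : hom Y Z) (f : hom X Y),
    comp h (comp g f) = comp (comp h g) f;
  comp_bilinear : forall X Y Z, bilinear_map (@comp X Y Z);
  thom_id : forall X Y, thom (idc X) (idc Y) = idc (tob X Y);
  thom_comp : forall X X' X'' Y Y' Y''
    (g : hom X' X'') (f : hom X X') (g' : hom Y' Y'') (f' : hom Y Y'),
    thom (comp g f) (comp g' f') = comp (thom g g') (thom f f');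
  thom_bilinear : forall X X' Y Y', bilinear_map (@thom X X' Y Y');
  assocK : forall X Y Z, comp (assoc_inv X Y Z) (assoc X Y Z) = idc _;
  assoc_invK : forall X Y Z, comp (assoc X Y Z) (assoc_inv X Y Z) = idc _;
  assoc_nat : forall X X' Y Y' Z Z'
    (f : hom X X') (g : hom Y Y') (h : hom Z Z'),
    comp (assoc X' Y' Z') (thom (thom f g) h)
    = comp (thom f (thom g h)) (assoc X Y Z);
  lunitK : forall X, comp (lunit_inv X) (lunit X) = idc _;
  lunit_invK : forall X, comp (lunit X) (lunit_inv X) = idc _;
  lunit_nat : forall X Y (f : hom X Y),
    comp (lunit Y) (thom (idc unit_ob) f) = comp f (lunit X);
  runitK : forall X, comp (runit_inv X) (runit X) = idc _;
  runit_invK : forall X, comp (runit X) (runit_inv X) = idc _;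
  runit_nat : forall X Y (f : hom X Y),
    comp (runit Y) (thom f (idc unit_ob)) = comp f (runit X);
  braid_nat : forall X X' Y Y' (f : hom X X') (g : hom Y Y'),
    comp (braid X' Y') (thom f g) = comp (thom g f) (braid X Y);
  braidK : forall X Y, comp (braid Y X) (braid X Y) = idc _;
  triangle : forall X Y,
    comp (thom (idc X) (lunit Y)) (assoc X unit_ob Y)
    = thom (runit X) (idc Y);
  pentagon : forall X Y Z T,
    comp (assoc X Y (tob Z T)) (assoc (tob X Y) Z T)
    = comp (thom (idc X) (assoc Y Z T))
        (comp (assoc X (tob Y Z) T) (thom (assoc X Y Z) (idc T)));
  hexagon : forall X Y Z,
    comp (assoc Y Z X) (comp (braid X (tob Y Z)) (assoc X Y Z))
    = comp (thom (idc Y) (braid X Z))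
        (comp (assoc Y X Z) (thom (braid X Y) (idc Z))) }.

Arguments hom {K _} X Y.
Arguments idc {K _} X.
Arguments comp {K _ X Y Z} g f.
Arguments tob {K _} X Y.
Arguments thom {K _ X X' Y Y'} f g.
Arguments unit_ob {K} _.
Arguments assoc {K _} X Y Z.
Arguments assoc_inv {K _} X Y Z.
Arguments lunit {K _} X.
Arguments lunit_inv {K _} X.
Arguments runit {K _} X.
Arguments runit_inv {K _} X.
Arguments braid {K _} X Y.

Section SuperVectorSpaces.
Variable K : fieldType.
Implicit Types V W U X : superSpace K.

Lemma scomp_bilinear U V W : bilinear_map (@scomp K U V W).
Proof.
split=> [g|f] a x y; apply: shomP => u //.
by rewrite /= shom_linear.
Qed.

Lemma sthom_bilin V V' W W' (f : shom V V') (g : shom W W') :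
  bilinear_map (fun v w => tens (f v) (g w)).
Proof.
by split=> [v|w] a x y; rewrite shom_linear; [apply: tensl|apply: tensr].
Qed.

Lemma sthom_part V V' W W' (f : shom V V') (g : shom W W') i j v w :
  part V i v -> part W j w -> part (stensor V' W') (i (+) j) (tens (f v) (g w)).
Proof. by move=> hv hw; apply: tens_part; apply: shom_part. Qed.

Definition sthom V V' W W' (f : shom V V') (g : shom W W') :
    shom (stensor V W) (stensor V' W') :=
  slift (U := stensor V' W') (sthom_bilin f g) (@sthom_part _ _ _ _ f g).

Lemma sthomE V V' W W' (f : shom V V') (g : shom W W') v w :
  sthom f g (tens v w) = tens (f v) (g w).
Proof. exact: sliftE. Qed.

Lemma sassoc_aux V W U (u : U) :
  bilinear_map (fun (v : V) (w : W) => tens v (tens w u : stensor W U)).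
Proof.
split=> [v|w].
- exact: comp_linear (tensl v) (@tensr _ _ _ u).
- exact: tensr.
Qed.

Lemma sassoc_bilin V W U : bilinear_map (fun (t : stensor V W) (u : U) =>
  tensor_lift (fun v w => tens v (tens w u : stensor W U)) t).
Proof.
have h := @sassoc_aux V W U.
split=> [t|u]; last exact: tensor_lift_linear.
move=> a x y; move: t; apply: lin_ext2.
- exact: tensor_lift_linear.
- move=> b s t; rewrite !(tensor_lift_linear (h _)) !scalerDr !scalerA.
  by rewrite addrACA mulrC.
move=> i j v w _ _; rewrite !tensor_liftE //.
by rewrite (tensl w) (tensl v).
Qed.

Lemma sassoc_part V W U i j (t : stensor V W) (u : U) :
  part (stensor V W) i t -> part U j u ->
  part (stensor V (stensor W U)) (i (+) j)
    (tensor_lift (fun v w => tens v (tens w u : stensor W U)) t).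
Proof.
move=> ht hu; move: t ht; apply: tensor_part_ind.
  exact: (subspace_preim (tensor_lift_linear (@sassoc_aux V W U u))
    (part_subspace (stensor V (stensor W U)) _)).
move=> k l v w hv hw -> /=.
rewrite tensor_liftE; last exact: sassoc_aux.
by rewrite -addbA; do 2?apply: tens_part.
Qed.

Definition sassoc V W U :
    shom (stensor (stensor V W) U) (stensor V (stensor W U)) :=
  slift (U := stensor V (stensor W U)) (@sassoc_bilin V W U) (@sassoc_part V W U).

Lemma sassocE V W U (v : V) (w : W) (u : U) :
  sassoc V W U (tens (tens v w : stensor V W) u)
  = tens v (tens w u : stensor W U).
Proof. by rewrite sliftE tensor_liftE //; apply: sassoc_aux. Qed.

Lemma sassoc_inv_aux V W U (v : V) :
  bilinear_map (fun (w : W) (u : U) => tens (tens v w : stensor V W) u).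
Proof.
split=> [w|u].
- exact: tensl.
- exact: comp_linear (@tensr _ _ _ u) (tensl v).
Qed.

Lemma sassoc_inv_bilin V W U : bilinear_map (fun (v : V) (t : stensor W U) =>
  tensor_lift (fun w u => tens (tens v w : stensor V W) u) t).
Proof.
have h := @sassoc_inv_aux V W U.
split=> [v|t]; first exact: tensor_lift_linear.
move=> a x y; move: t; apply: lin_ext2.
- exact: tensor_lift_linear.
- move=> b s t; rewrite !(tensor_lift_linear (h _)) !scalerDr !scalerA.
  by rewrite addrACA mulrC.
move=> i j w u _ _; rewrite !tensor_liftE //.
by rewrite (tensr w) (tensr u).
Qed.

Lemma sassoc_inv_part V W U i j (v : V) (t : stensor W U) :
  part V i v -> part (stensor W U) j t ->
  part (stensor (stensor V W) U) (i (+) j)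
    (tensor_lift (fun w u => tens (tens v w : stensor V W) u) t).
Proof.
move=> hv; move: t; apply: tensor_part_ind.
  exact: (subspace_preim (tensor_lift_linear (@sassoc_inv_aux V W U v))
    (part_subspace (stensor (stensor V W) U) _)).
move=> k l w u hw hu -> /=.
rewrite tensor_liftE; last exact: sassoc_inv_aux.
by rewrite addbA; do 2?apply: tens_part.
Qed.

Definition sassoc_inv V W U :
    shom (stensor V (stensor W U)) (stensor (stensor V W) U) :=
  slift (U := stensor (stensor V W) U) (@sassoc_inv_bilin V W U) (@sassoc_inv_part V W U).

Lemma sassoc_invE V W U (v : V) (w : W) (u : U) :
  sassoc_inv V W U (tens v (tens w u : stensor W U))
  = tens (tens v w : stensor V W) u.
Proof. by rewrite sliftE tensor_liftE //; apply: sassoc_inv_aux. Qed.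

Lemma slunit_bilin V : bilinear_map (fun (k : sunit K) (v : V) => (k : K) *: v).
Proof.
split=> [k|v] a x y; first by rewrite scalerDr !scalerA mulrC.
by rewrite scalerDl scalerA.
Qed.

Lemma slunit_part V i j (k : sunit K) (v : V) :
  part (sunit K) i k -> part V j v -> part V (i (+) j) ((k : K) *: v).
Proof.
case: i => /= [->|_] hv; first by rewrite scale0r; apply: part0.
by apply: subspaceZ => //; apply: part_subspace.
Qed.

Definition slunit V : shom (stensor (sunit K) V) V :=
  slift (@slunit_bilin V) (@slunit_part V).

Lemma slunitE V k v : slunit V (tens k v) = (k : K) *: v.
Proof. exact: sliftE. Qed.

Lemma slunit_inv_part V i v :
  part V i v -> part (stensor (sunit K) V) i (tens (1 : sunit K) v).
Proof. by move=> hv; apply: (@tens_part _ (sunit K) V false i). Qed.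

Definition slunit_inv V : shom V (stensor (sunit K) V) :=
  @mk_shom _ V (stensor (sunit K) V) _ (tensl (1 : sunit K)) (@slunit_inv_part V).

Lemma srunit_bilin V : bilinear_map (fun (v : V) (k : sunit K) => (k : K) *: v).
Proof. by have [h1 h2] := slunit_bilin V; split. Qed.

Lemma srunit_part V i j (v : V) (k : sunit K) :
  part V i v -> part (sunit K) j k -> part V (i (+) j) ((k : K) *: v).
Proof. by move=> hv hk; rewrite addbC; apply: slunit_part. Qed.

Definition srunit V : shom (stensor V (sunit K)) V :=
  slift (@srunit_bilin V) (@srunit_part V).

Lemma srunitE V k v : srunit V (tens v k) = (k : K) *: v.
Proof. exact: sliftE. Qed.

Lemma srunit_inv_part V i v :
  part V i v -> part (stensor V (sunit K)) i (tens v (1 : sunit K)).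
Proof. by move=> hv; rewrite -(addbF i); apply: (@tens_part _ V (sunit K)). Qed.

Definition srunit_inv V : shom V (stensor V (sunit K)) :=
  @mk_shom _ V (stensor V (sunit K)) _ (@tensr _ _ _ (1 : sunit K)) (@srunit_inv_part V).

(* v (x) w |-> (-1)^(|v||w|) w (x) v, extended bilinearly from homogeneous
   vectors through their components; see sbraidE. *)
Definition sbraid_fun V W (v : V) (w : W) : stensor W V :=
  \sum_(i : bool) \sum_(j : bool)
    (-1) ^+ (i && j) *: tens (proj j w) (proj i v).

Lemma sbraid_bilin V W : bilinear_map (@sbraid_fun V W).
Proof.
split=> [v|w]; apply: lin_sum => i; apply: lin_sum => j a x y;
  rewrite proj_linear.
- by rewrite (tensr (proj i v)) scalerDr !scalerA mulrC.
- by rewrite (tensl (proj j w)) scalerDr !scalerA mulrC.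
Qed.

Lemma sbraid_part V W i j (v : V) (w : W) : part V i v -> part W j w ->
  part (stensor W V) (i (+) j) (sbraid_fun v w).
Proof.
move=> hv hw; have hP := part_subspace (stensor W V) (i (+) j).
have h k l : part (stensor W V) (i (+) j) ((-1) ^+ (k && l) *: tens (proj l w) (proj k v)).
  apply: (subspaceZ _ hP); rewrite (projE _ hv) (projE _ hw) addbC.
  by apply: tens_part; case: eqP => // _; apply: part0.
by rewrite /sbraid_fun !big_bool; apply: (subspaceD hP); apply: (subspaceD hP); apply: h.
Qed.

Definition sbraid V W : shom (stensor V W) (stensor W V) :=
  slift (@sbraid_bilin V W) (@sbraid_part V W).

Lemma sbraidE V W i j (v : V) (w : W) : part V i v -> part W j w ->
  sbraid V W (tens v w) = (-1) ^+ (i && j) *: tens w v.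
Proof.
move=> hv hw; rewrite sliftE /sbraid_fun (bigD1 i) //= (bigD1 j) //=.
rewrite (projE _ hv) (projE _ hw) !eqxx.
have t0 (k : W) : tens k 0 = 0 :> tensor W V by exact: linear_fun0 (tensl k).
have t0' (k : V) : tens 0 k = 0 :> tensor W V by exact: linear_fun0 (@tensr _ _ _ k).
rewrite big1 ?addr0 => [|k kj]; last first.
  by rewrite (projE _ hw) eq_sym (negbTE kj) t0' scaler0.
rewrite big1 ?addr0 // => k ki; rewrite big1 // => l _.
by rewrite (projE _ hv) eq_sym (negbTE ki) t0 scaler0.
Qed.

Lemma shomZ V W (f : shom V W) a v : f (a *: v) = a *: f v.
Proof. exact: linear_funZ (shom_linear f). Qed.

Lemma tensZl V W a (v : V) (w : W) : tens (a *: v) w = a *: tens v w.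
Proof. exact: linear_funZ (@tensr _ _ _ w). Qed.
Lemma tensZr V W a (v : V) (w : W) : tens v (a *: w) = a *: tens v w.
Proof. exact: linear_funZ (tensl v). Qed.

Lemma scompE U V W (g : shom V W) (f : shom U V) u : scomp g f u = g (f u).
Proof. by []. Qed.
Lemma sidE V v : sid V v = v.
Proof. by []. Qed.

Lemma scomp_idl V W (f : shom V W) : scomp (sid W) f = f.
Proof. exact: shomP. Qed.
Lemma scomp_idr V W (f : shom V W) : scomp f (sid V) = f.
Proof. exact: shomP. Qed.
Lemma scomp_assoc V W U X (h : shom U X) (g : shom W U) (f : shom V W) :
  scomp h (scomp g f) = scomp (scomp h g) f.
Proof. exact: shomP. Qed.

Lemma sthom_id V W : sthom (sid V) (sid W) = sid (stensor V W).
Proof. by apply: shom_ext2 => i j v w _ _; rewrite sthomE. Qed.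

Lemma sthom_comp X X' X'' Y Y' Y'' (g : shom X' X'') (f : shom X X')
    (g' : shom Y' Y'') (f' : shom Y Y') :
  sthom (scomp g f) (scomp g' f') = scomp (sthom g g') (sthom f f').
Proof. by apply: shom_ext2 => i j v w _ _; rewrite scompE !sthomE. Qed.

Lemma sthom_bilinear X X' Y Y' : bilinear_map (@sthom X X' Y Y').
Proof.
split=> [f|g] a x y; apply: shom_ext2 => i j v w _ _;
  rewrite shomDE shomZE !sthomE shomDE shomZE.
- exact: tensl.
- exact: tensr.
Qed.

Lemma sassocK X Y Z : scomp (sassoc_inv X Y Z) (sassoc X Y Z) = sid _.
Proof.
by apply: shom_ext3l => i j k x y z _ _ _; rewrite scompE sassocE sassoc_invE.
Qed.

Lemma sassoc_invK X Y Z : scomp (sassoc X Y Z) (sassoc_inv X Y Z) = sid _.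
Proof.
by apply: shom_ext3r => i j k x y z _ _ _; rewrite scompE sassoc_invE sassocE.
Qed.

Lemma sassoc_nat X X' Y Y' Z Z' (f : shom X X') (g : shom Y Y') (h : shom Z Z') :
  scomp (sassoc X' Y' Z') (sthom (sthom f g) h)
  = scomp (sthom f (sthom g h)) (sassoc X Y Z).
Proof.
apply: shom_ext3l => i j k x y z _ _ _.
by rewrite !scompE sassocE !sthomE sassocE.
Qed.

Lemma slunitK X : scomp (slunit_inv X) (slunit X) = sid _.
Proof.
apply: shom_ext2 => i j k x _ _; rewrite scompE slunitE shomZ sidE.
by rewrite -tensZl /GRing.scale /= mulr1.
Qed.

Lemma slunit_invK X : scomp (slunit X) (slunit_inv X) = sid _.
Proof. by apply: shomP => x; rewrite scompE slunitE scale1r. Qed.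

Lemma slunit_nat X Y (f : shom X Y) :
  scomp (slunit Y) (sthom (sid (sunit K)) f) = scomp f (slunit X).
Proof.
by apply: shom_ext2 => i j k x _ _; rewrite !scompE sthomE !slunitE shomZ.
Qed.

Lemma srunitK X : scomp (srunit_inv X) (srunit X) = sid _.
Proof.
apply: shom_ext2 => i j x k _ _; rewrite scompE srunitE shomZ sidE.
by rewrite -tensZr /GRing.scale /= mulr1.
Qed.

Lemma srunit_invK X : scomp (srunit X) (srunit_inv X) = sid _.
Proof. by apply: shomP => x; rewrite scompE srunitE scale1r. Qed.

Lemma srunit_nat X Y (f : shom X Y) :
  scomp (srunit Y) (sthom f (sid (sunit K))) = scomp f (srunit X).
Proof.
by apply: shom_ext2 => i j k x _ _; rewrite !scompE sthomE !srunitE shomZ.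
Qed.

Lemma sbraid_nat X X' Y Y' (f : shom X X') (g : shom Y Y') :
  scomp (sbraid X' Y') (sthom f g) = scomp (sthom g f) (sbraid X Y).
Proof.
apply: shom_ext2 => i j x y hx hy; rewrite !scompE sthomE.
by rewrite (sbraidE hx hy) (sbraidE (shom_part f hx) (shom_part g hy)) shomZ sthomE.
Qed.

Lemma sbraidK X Y : scomp (sbraid Y X) (sbraid X Y) = sid _.
Proof.
apply: shom_ext2 => i j x y hx hy; rewrite scompE (sbraidE hx hy) shomZ.
by rewrite (sbraidE hy hx) scalerA andbC -expr2 sqrr_sign scale1r.
Qed.

Lemma striangle X Y :
  scomp (sthom (sid X) (slunit Y)) (sassoc X (sunit K) Y)
  = sthom (srunit X) (sid Y).
Proof.
apply: shom_ext3l => i j l x k y _ _ _.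
by rewrite scompE sassocE !sthomE slunitE srunitE tensZl tensZr.
Qed.

Lemma spentagon X Y Z T :
  scomp (sassoc X Y (stensor Z T)) (sassoc (stensor X Y) Z T)
  = scomp (sthom (sid X) (sassoc Y Z T))
      (scomp (sassoc X (stensor Y Z) T) (sthom (sassoc X Y Z) (sid T))).
Proof.
apply: shom_ext4 => x y z t; rewrite !scompE sthomE !sassocE sthomE.
by rewrite sassocE.
Qed.

Lemma shexagon X Y Z :
  scomp (sassoc Y Z X) (scomp (sbraid X (stensor Y Z)) (sassoc X Y Z))
  = scomp (sthom (sid Y) (sbraid X Z))
      (scomp (sassoc Y X Z) (sthom (sbraid X Y) (sid Z))).
Proof.
apply: shom_ext3l => i j k x y z hx hy hz.
have hyz : part (stensor Y Z) (j (+) k) (tens y z) by exact: tens_part.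
rewrite !scompE sassocE (sbraidE hx hyz) shomZ sassocE sthomE (sbraidE hx hy).
rewrite tensZl !shomZ sassocE sthomE (sbraidE hx hz) tensZr scalerA.
by rewrite andb_addr signr_addb.
Qed.

Definition sVec : linSymMonCat K :=
  @LinSymMonCat K (superSpace K) (fun V W => shom V W : lmodType K)
    (@sid K) (@scomp K) (@stensor K) sthom (sunit K) sassoc sassoc_inv
    slunit slunit_inv srunit srunit_inv sbraid
    scomp_idl scomp_idr scomp_assoc scomp_bilinear
    sthom_id sthom_comp sthom_bilinear
    sassocK sassoc_invK sassoc_nat
    slunitK slunit_invK slunit_nat srunitK srunit_invK srunit_nat
    sbraid_nat sbraidK striangle spentagon shexagon.

End SuperVectorSpaces.

Local Notation "g ∘ f" := (comp g f) (at level 40, left associativity).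
Local Notation "f ⊗ g" := (thom f g) (at level 35, right associativity).
Local Notation "X ⊠ Y" := (tob X Y) (at level 35, right associativity).

(* Associators are written out: every axiom on three factors is an equation
   between morphisms out of a left-bracketed product. *)
Section LieRinehartMonoids.
Variables (K : fieldType) (C : linSymMonCat K).

Record comm_monoid_axioms (A : C)
    (m : hom (A ⊠ A) A) (eta : hom (unit_ob C) A) : Prop := {
  monoid_assoc : m ∘ (m ⊗ idc A) = m ∘ (idc A ⊗ m) ∘ assoc A A A;
  monoid_unitl : m ∘ (eta ⊗ idc A) = lunit A;
  monoid_unitr : m ∘ (idc A ⊗ eta) = runit A;
  monoid_comm : m ∘ braid A A = m }.

Record lie_monoid_axioms (L : C) (mu : hom (L ⊠ L) L) : Prop := {
  lie_monoid_skew : mu = - (mu ∘ braid L L);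
  lie_monoid_jacobi :
    mu ∘ (idc L ⊗ mu) ∘ assoc L L L
    = mu ∘ (mu ⊗ idc L)
      + mu ∘ (idc L ⊗ mu) ∘ assoc L L L ∘ (braid L L ⊗ idc L) }.

Record module_axioms (A L : C) (m : hom (A ⊠ A) A)
    (eta : hom (unit_ob C) A) (beta : hom (A ⊠ L) L) : Prop := {
  module_assoc :
    beta ∘ (m ⊗ idc L) = beta ∘ (idc A ⊗ beta) ∘ assoc A A L;
  module_unit : beta ∘ (eta ⊗ idc L) = lunit L }.

Record LieRinehartMonoid (A L : C) := {
  lrm_mul : hom (A ⊠ A) A;
  lrm_unit : hom (unit_ob C) A;
  lrm_bracket : hom (L ⊠ L) L;
  lrm_anchor : hom (L ⊠ A) A;
  lrm_act : hom (A ⊠ L) L;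
  lrm_comm_monoid : comm_monoid_axioms lrm_mul lrm_unit;
  lrm_lie_monoid : lie_monoid_axioms lrm_bracket;
  lrm_module : module_axioms lrm_mul lrm_unit lrm_act;
  lrm_anchor_mul :
    lrm_anchor ∘ (idc L ⊗ lrm_mul) ∘ assoc L A A
    = lrm_mul ∘ (lrm_anchor ⊗ idc A)
      + lrm_mul ∘ (idc A ⊗ lrm_anchor) ∘ assoc A L A ∘ (braid L A ⊗ idc A);
  lrm_anchor_act :
    lrm_anchor ∘ (lrm_act ⊗ idc A)
    = lrm_mul ∘ (idc A ⊗ lrm_anchor) ∘ assoc A L A;
  lrm_anchor_bracket :
    lrm_anchor ∘ (idc L ⊗ lrm_anchor) ∘ assoc L L A
    = lrm_anchor ∘ (lrm_bracket ⊗ idc A)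
      + lrm_anchor ∘ (idc L ⊗ lrm_anchor) ∘ assoc L L A
          ∘ (braid L L ⊗ idc A);
  lrm_bracket_act :
    lrm_bracket ∘ (idc L ⊗ lrm_act) ∘ assoc L A L
    = lrm_act ∘ (lrm_anchor ⊗ idc L)
      + lrm_act ∘ (idc A ⊗ lrm_bracket) ∘ assoc A L L
          ∘ (braid L A ⊗ idc L) }.

End LieRinehartMonoids.

Section LieRinehartSuperalgebras.
Variable K : fieldType.
Implicit Types A L : superSpace K.

(* No evenness axiom for the unit: it follows from the grading of the product. *)
Record superalgebra A := {
  sa_mul : A -> A -> A;
  sa_one : A;
  sa_bilinear : bilinear_map sa_mul;
  sa_part : forall i j a b,
    part A i a -> part A j b -> part A (i (+) j) (sa_mul a b);
  sa_assoc : associative sa_mul;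
  sa_mul1l : left_id sa_one sa_mul;
  sa_mul1r : right_id sa_one sa_mul }.

Definition supercommutative A (S : superalgebra A) : Prop :=
  forall i j a b, part A i a -> part A j b ->
    sa_mul S a b = (-1) ^+ (i && j) *: sa_mul S b a.

Record lieSuperalgebra L := {
  ls_bracket : L -> L -> L;
  ls_bilinear : bilinear_map ls_bracket;
  ls_part : forall i j x y,
    part L i x -> part L j y -> part L (i (+) j) (ls_bracket x y);
  ls_skew : forall i j x y, part L i x -> part L j y ->
    ls_bracket x y = - ((-1) ^+ (i && j) *: ls_bracket y x);
  ls_jacobi : forall i j k x y z,
    part L i x -> part L j y -> part L k z ->
    ls_bracket x (ls_bracket y z)
    = ls_bracket (ls_bracket x y) z
      + (-1) ^+ (i && j) *: ls_bracket y (ls_bracket x z) }.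

Record superModule A (S : superalgebra A) L := {
  sm_act : A -> L -> L;
  sm_bilinear : bilinear_map sm_act;
  sm_part : forall i j a x,
    part A i a -> part L j x -> part L (i (+) j) (sm_act a x);
  sm_assoc : forall a b x, sm_act (sa_mul S a b) x = sm_act a (sm_act b x);
  sm_act1 : forall x, sm_act (sa_one S) x = x }.

Section Superderivations.
Variables (A : superSpace K) (S : superalgebra A).

Definition superderivation (d : bool) : set (A -> A) :=
  [set f | [/\ linear f,
    forall i a, part A i a -> part A (d (+) i) (f a)
  & forall i a b, part A i a ->
      f (sa_mul S a b)
      = sa_mul S (f a) b + (-1) ^+ (i && d) *: sa_mul S a (f b)]].

Lemma superderivation_subspace d : subspace (superderivation d).
Proof.
have [ml mr] := sa_bilinear S.
split.
  split=> [a u v|i a _|i a b _]; first by rewrite scaler0 addr0.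
  - exact: part0.
  - rewrite (linear_fun0 (mr b)) (_ : sa_mul S a 0 = 0) ?scaler0 ?addr0 //.
    exact: linear_fun0 (ml a).
move=> c f g [fl fd fm] [gl gd gm]; split=> [a u v|i a ha|i a b ha].
- rewrite !fctE /= fl gl !scalerDr !scalerA mulrC.
  by rewrite addrACA.
- case: (part_subspace A (d (+) i)) => _; apply; [exact: fd | exact: gd].
- rewrite !fctE /= (fm _ _ _ ha) (gm _ _ _ ha) (mr b) (ml a) !scalerDr.
  by rewrite !scalerA mulrC addrACA.
Qed.

Definition sder_pred : {pred A -> A} := fun f =>
  `[< exists f0 f1 : A -> A,
      [/\ superderivation false f0, superderivation true f1 & f = f0 + f1] >].

Record sder := Sder { sder_fun :> A -> A; _ : sder_fun \in sder_pred }.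

Lemma sder_closed : submod_closed sder_pred.
Proof.
have h := superderivation_subspace.
split.
  by apply/asboolP; exists 0, 0; split; rewrite ?addr0 //; case: (h false) (h true) => ? _ [].
move=> a f g /asboolP [f0 [f1 [hf0 hf1 ->]]] /asboolP [g0 [g1 [hg0 hg1 ->]]].
apply/asboolP; exists (a *: f0 + g0), (a *: f1 + g1); split.
- by case: (h false) => _; apply.
- by case: (h true) => _; apply.
- by rewrite scalerDr addrACA.
Qed.

HB.instance Definition _ := GRing.isSubmodClosed.Build K (A -> A) sder_pred
  (GRing.submod_closed_semi sder_closed).
HB.instance Definition _ := [isSub for sder_fun].
HB.instance Definition _ := [Choice of sder by <:].
HB.instance Definition _ := [SubChoice_isSubLmodule of sder by <:].

Definition sder_part (d : bool) : set sder := [set f | superderivation d f].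

Lemma sder_part_subspace d : subspace (sder_part d).
Proof.
by case: (superderivation_subspace d) => h0 h; split=> // a f g; apply: h.
Qed.

Lemma superderivation_sder d f : superderivation d f -> f \in sder_pred.
Proof.
have h k := superderivation_subspace k.
move=> hf; apply/asboolP; case: d hf => hf.
- by exists 0, f; split; rewrite ?add0r //; case: (h false).
- by exists f, 0; split; rewrite ?addr0 //; case: (h true).
Qed.

Lemma sder_decomp (f : sder) : exists! p : sder * sder,
  [/\ sder_part false p.1, sder_part true p.2 & f = p.1 + p.2].
Proof.
apply: (decomp_unique sder_part_subspace) => {f} [[f hf]|f h0 h1].
  have /asboolP [f0 [f1 [hf0 hf1 ef]]] := hf.
  exists (Sder (superderivation_sder hf0), Sder (superderivation_sder hf1)).
  by split=> //; apply: val_inj.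
apply: val_inj; apply: funext => a /=.
case: h0 h1 => [fl h0 _] [_ h1 _].
have z k : f (proj k a) = 0.
  have p := proj_part k a.
  have := projE k (h0 _ _ p); rewrite (projE k (h1 _ _ p)) /= eqxx.
  by case: k {p}.
by rewrite [a]proj_sum (linear_funD _ _ fl) !z addr0.
Qed.

Definition sDer : superSpace K :=
  @SuperSpace K sder sder_part sder_part_subspace sder_decomp.

End Superderivations.

(* lrs_anchor_bracket and lrs_anchor_act say that the anchor is a morphism of
   Lie superalgebras and of A-modules: the bracket
   [f, g] = f o g - (-1)^(|f||g|) g o f and the action (a . f)(b) = a f(b) of
   sDer(A) are evaluated at b. *)
Record LieRinehartSuperalgebra A L := {
  lrs_alg : superalgebra A;
  lrs_comm : supercommutative lrs_alg;
  lrs_lie : lieSuperalgebra L;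
  lrs_mod : superModule lrs_alg L;
  lrs_anchor : shom L (sDer lrs_alg);
  lrs_anchor_bracket : forall i j x y b, part L i x -> part L j y ->
    lrs_anchor (ls_bracket lrs_lie x y) b
    = lrs_anchor x (lrs_anchor y b)
      - (-1) ^+ (i && j) *: lrs_anchor y (lrs_anchor x b);
  lrs_anchor_act : forall a x b,
    lrs_anchor (sm_act lrs_mod a x) b = sa_mul lrs_alg a (lrs_anchor x b);
  lrs_bracket_act : forall i j a x y, part A i a -> part L j x ->
    ls_bracket lrs_lie x (sm_act lrs_mod a y)
    = (-1) ^+ (i && j) *: sm_act lrs_mod a (ls_bracket lrs_lie x y)
      + sm_act lrs_mod (lrs_anchor x a) y }.

Record same_operations A L (M : @LieRinehartMonoid K (sVec K) A L)
    (S : LieRinehartSuperalgebra A L) : Prop := {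
  same_mul : forall a b : A,
    (lrm_mul M : shom (stensor A A) A) (tens a b) = sa_mul (lrs_alg S) a b;
  same_one :
    (lrm_unit M : shom (sunit K) A) (1 : K) = sa_one (lrs_alg S);
  same_bracket : forall x y : L,
    (lrm_bracket M : shom (stensor L L) L) (tens x y)
    = ls_bracket (lrs_lie S) x y;
  same_anchor : forall (x : L) (a : A),
    (lrm_anchor M : shom (stensor L A) A) (tens x a) = lrs_anchor S x a;
  same_act : forall (a : A) (x : L),
    (lrm_act M : shom (stensor A L) L) (tens a x) = sm_act (lrs_mod S) a x }.

End LieRinehartSuperalgebras.

(* Main.v *)
Require Import Defs.
From mathcomp Require Import all_boot all_order all_algebra.
From mathcomp Require Import boolp classical_sets functions reals complex.

Set Implicit Arguments.
Unset Strict Implicit.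
Unset Printing Implicit Defensive.

Import GRing.Theory.
Local Open Scope ring_scope.

(* A bilinear map that respects degrees is the same thing as an even map out of
   the tensor product, and two even maps out of a tensor product agree as soon
   as they agree on tensors of homogeneous vectors.  Evaluated there, where the
   braiding is the Koszul sign, each diagram of a Lie-Rinehart monoid becomes
   the corresponding identity of a Lie-Rinehart superalgebra. *)

(** * Even maps and composites on homogeneous tensors *)

Section Evaluation.
Variable K : fieldType.
Implicit Types V W U X : superSpace K.

Lemma shomNE V W (f : shom V W) v : (- f) v = - f v.
Proof. by []. Qed.

Lemma shom_tens_bilinear V W U (f : shom (stensor V W) U) :
  bilinear_map (fun v w => f (tens v w)).
Proof.
by split=> [v|w] a x y; rewrite -shom_linear; [rewrite tensl|rewrite (tensr w)].
Qed.

Lemma shom_tens_part V W U (f : shom (stensor V W) U) i j v w :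
  part V i v -> part W j w -> part U (i (+) j) (f (tens v w)).
Proof. by move=> hv hw; apply: shom_part; apply: tens_part. Qed.

Section Composites.
Variables V W U X Y : superSpace K.
Variables (x : V) (y : W) (z : U).
Let xyz : stensor (stensor V W) U := tens (tens x y : stensor V W) z.

(** Each side of a three-factor axiom is one of the three composites evaluated here, or a sum of two
    of them, so these formulas turn a diagram into an identity between values. *)
Lemma comp_thoml_tens (g : shom (stensor X U) Y) (f : shom (stensor V W) X) :
  scomp g (sthom f (sid U)) xyz = g (tens (f (tens x y)) z).
Proof. by rewrite scompE sthomE. Qed.

Lemma comp_thomr_tens (g : shom (stensor V X) Y) (f : shom (stensor W U) X) :
  scomp (scomp g (sthom (sid V) f)) (sassoc V W U) xyz
  = g (tens x (f (tens y z))).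
Proof. by rewrite !scompE sassocE sthomE. Qed.

(** The braiding only exchanges the first two factors, so the sign depends on their degrees alone
    and [z] may be any vector. *)
Lemma comp_thomr_braid_tens (g : shom (stensor W X) Y)
    (f : shom (stensor V U) X) i j : part V i x -> part W j y ->
  scomp (scomp (scomp g (sthom (sid W) f)) (sassoc W V U))
    (sthom (sbraid V W) (sid U)) xyz
  = (-1) ^+ (i && j) *: g (tens y (f (tens x z))).
Proof.
move=> hx hy; rewrite !scompE sthomE (sbraidE hx hy) tensZl !shomZ.
by rewrite sassocE sthomE.
Qed.

End Composites.

Lemma comp_braid_tens V W Y (g : shom (stensor W V) Y) i j x y :
  part V i x -> part W j y ->
  scomp g (sbraid V W) (tens x y) = (-1) ^+ (i && j) *: g (tens y x).
Proof. by move=> hx hy; rewrite scompE (sbraidE hx hy) shomZ. Qed.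

End Evaluation.

(** * From Lie-Rinehart monoids to Lie-Rinehart superalgebras *)

Section MonoidToSuperalgebra.
Variables (K : fieldType) (A L : superSpace K).
Variable M : @LieRinehartMonoid K (sVec K) A L.

Let m : shom (stensor A A) A := lrm_mul M.
Let eta : shom (sunit K) A := lrm_unit M.
Let mu : shom (stensor L L) L := lrm_bracket M.
Let al : shom (stensor L A) A := lrm_anchor M.
Let be : shom (stensor A L) L := lrm_act M.

Lemma monoid_superalgebra_assoc : associative (fun a b : A => m (tens a b)).
Proof.
move=> a b c.
(* The axiom, stated in the abstract category, is restated by conversion with the concrete [scomp],
   [sthom] and [sassoc], on which the evaluation lemmas act. The other axioms are treated alike. *)
have h : scomp m (sthom m (sid A))
    = scomp (scomp m (sthom (sid A) m)) (sassoc A A A).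
  exact: (monoid_assoc (lrm_comm_monoid M)).
by rewrite -comp_thomr_tens -h comp_thoml_tens.
Qed.

Lemma monoid_superalgebra_mul1l :
  left_id (eta (1 : K)) (fun a b : A => m (tens a b)).
Proof.
move=> a.
have h : scomp m (sthom eta (sid A)) = slunit A.
  exact: (monoid_unitl (lrm_comm_monoid M)).
(* The unit constraint is scalar multiplication, so at the scalar 1 it returns [a]. *)
have := congr1 (fun f : shom (stensor (sunit K) A) A => f (tens (1 : sunit K) a)) h.
by rewrite scompE sthomE slunitE scale1r.
Qed.

Lemma monoid_superalgebra_mul1r :
  right_id (eta (1 : K)) (fun a b : A => m (tens a b)).
Proof.
move=> a.
have h : scomp m (sthom (sid A) eta) = srunit A.
  exact: (monoid_unitr (lrm_comm_monoid M)).
have := congr1 (fun f : shom (stensor A (sunit K)) A => f (tens a (1 : sunit K))) h.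
by rewrite scompE sthomE srunitE scale1r.
Qed.

Definition monoid_superalgebra : superalgebra A :=
  Build_superalgebra (shom_tens_bilinear m) (shom_tens_part m)
    monoid_superalgebra_assoc monoid_superalgebra_mul1l
    monoid_superalgebra_mul1r.

Lemma monoid_supercommutative : supercommutative monoid_superalgebra.
Proof.
move=> i j a b ha hb.
have h : scomp m (sbraid A A) = m.
  exact: (monoid_comm (lrm_comm_monoid M)).
by rewrite /= -(comp_braid_tens m ha hb) h.
Qed.

Lemma monoid_lie_skew i j x y : part L i x -> part L j y ->
  mu (tens x y) = - ((-1) ^+ (i && j) *: mu (tens y x)).
Proof.
move=> hx hy.
have h : mu = - scomp mu (sbraid L L).
  exact: (lie_monoid_skew (lrm_lie_monoid M)).
by rewrite {1}h shomNE (comp_braid_tens mu hx hy).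
Qed.

Lemma monoid_lie_jacobi i j x y z : part L i x -> part L j y ->
  mu (tens x (mu (tens y z)))
  = mu (tens (mu (tens x y)) z)
    + (-1) ^+ (i && j) *: mu (tens y (mu (tens x z))).
Proof.
move=> hx hy.
have h : scomp (scomp mu (sthom (sid L) mu)) (sassoc L L L)
    = scomp mu (sthom mu (sid L))
      + scomp (scomp (scomp mu (sthom (sid L) mu)) (sassoc L L L))
          (sthom (sbraid L L) (sid L)).
  exact: (lie_monoid_jacobi (lrm_lie_monoid M)).
by rewrite -comp_thomr_tens h shomDE comp_thoml_tens
  (comp_thomr_braid_tens _ _ _ hx hy).
Qed.

Definition monoid_lieSuperalgebra : lieSuperalgebra L :=
  Build_lieSuperalgebra (shom_tens_bilinear mu) (shom_tens_part mu) monoid_lie_skew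
    (fun i j k x y z hx hy _ => monoid_lie_jacobi z hx hy).

Lemma monoid_module_assoc a b x :
  be (tens (sa_mul monoid_superalgebra a b) x) = be (tens a (be (tens b x))).
Proof.
have h : scomp be (sthom m (sid L))
    = scomp (scomp be (sthom (sid A) be)) (sassoc A A L).
  exact: (module_assoc (lrm_module M)).
by rewrite -comp_thomr_tens -h comp_thoml_tens.
Qed.

Lemma monoid_module_act1 x :
  be (tens (sa_one monoid_superalgebra) x) = x.
Proof.
have h : scomp be (sthom eta (sid L)) = slunit L.
  exact: (module_unit (lrm_module M)).
have := congr1 (fun f : shom (stensor (sunit K) L) L => f (tens (1 : sunit K) x)) h.
by rewrite scompE sthomE slunitE scale1r.
Qed.

Definition monoid_superModule : superModule monoid_superalgebra L :=
  Build_superModule (shom_tens_bilinear be) (shom_tens_part be)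
    monoid_module_assoc monoid_module_act1.

(** With [x] fixed, [lrm_anchor_mul] is the Leibniz rule: braiding [x] past [a] yields the sign of a
    derivation of degree [d]. *)
Lemma monoid_anchor_superderivation d x : part L d x ->
  superderivation monoid_superalgebra d (fun a => al (tens x a)).
Proof.
move=> hx; have [all _] := shom_tens_bilinear al.
split=> [|i a ha|i a b ha]; [exact: all|exact: shom_tens_part|].
have h : scomp (scomp al (sthom (sid L) m)) (sassoc L A A)
    = scomp m (sthom al (sid A))
      + scomp (scomp (scomp m (sthom (sid A) al)) (sassoc A L A))
          (sthom (sbraid L A) (sid A)).
  exact: (lrm_anchor_mul M).
by rewrite /= -comp_thomr_tens h shomDE comp_thoml_tens
  (comp_thomr_braid_tens _ _ _ hx ha) andbC.
Qed.

(** For inhomogeneous [x], the even and odd components of [x] act by superderivations of degrees 0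
    and 1, and linearity adds them. *)
Lemma monoid_anchor_sder x :
  (fun a => al (tens x a)) \in sder_pred monoid_superalgebra.
Proof.
apply/asboolP; exists (fun a => al (tens (proj false x) a)).
exists (fun a => al (tens (proj true x) a)).
split; try exact/monoid_anchor_superderivation/proj_part.
apply: funext => a; rewrite {1}[x]proj_sum.
have [_ alr] := shom_tens_bilinear al.
by rewrite (linear_funD _ _ (alr a)).
Qed.

Definition monoid_anchor_fun (x : L) : sDer monoid_superalgebra :=
  Sder (monoid_anchor_sder x).

Lemma monoid_anchor_linear : linear monoid_anchor_fun.
Proof.
move=> c x y; apply: val_inj; apply: funext => a.
by have [_ alr] := shom_tens_bilinear al; rewrite /= alr.
Qed.

(** The graded parts of [sDer] are the superderivations of a given degree, so evenness of the anchor
    is [monoid_anchor_superderivation] itself. *)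
Definition monoid_anchor : shom L (sDer monoid_superalgebra) :=
  mk_shom monoid_anchor_linear (@monoid_anchor_superderivation).

Lemma monoid_anchor_bracket i j x y b : part L i x -> part L j y ->
  monoid_anchor (ls_bracket monoid_lieSuperalgebra x y) b
  = monoid_anchor x (monoid_anchor y b)
    - (-1) ^+ (i && j) *: monoid_anchor y (monoid_anchor x b).
Proof.
move=> hx hy.
have h : scomp (scomp al (sthom (sid L) al)) (sassoc L L A)
    = scomp al (sthom mu (sid A))
      + scomp (scomp (scomp al (sthom (sid L) al)) (sassoc L L A))
          (sthom (sbraid L L) (sid A)).
  exact: (lrm_anchor_bracket M).
have : al (tens x (al (tens y b))) = al (tens (mu (tens x y)) b)
    + (-1) ^+ (i && j) *: al (tens y (al (tens x b))).
  by rewrite -comp_thomr_tens h shomDE comp_thoml_tens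
    (comp_thomr_braid_tens _ _ _ hx hy).
(* The axiom expands the composite as the bracket term plus the signed reverse composite; cancelling
   the latter exhibits the bracket term as a supercommutator. *)
by move=> /= ->; rewrite addrK.
Qed.

Lemma monoid_anchor_act a x b :
  monoid_anchor (sm_act monoid_superModule a x) b
  = sa_mul monoid_superalgebra a (monoid_anchor x b).
Proof.
have h : scomp al (sthom be (sid A))
    = scomp (scomp m (sthom (sid A) al)) (sassoc A L A).
  exact: (lrm_anchor_act M).
by rewrite /= -comp_thomr_tens -h comp_thoml_tens.
Qed.

Lemma monoid_bracket_act i j a x y : part A i a -> part L j x ->
  ls_bracket monoid_lieSuperalgebra x (sm_act monoid_superModule a y)
  = (-1) ^+ (i && j) *: sm_act monoid_superModule a
                          (ls_bracket monoid_lieSuperalgebra x y)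
    + sm_act monoid_superModule (monoid_anchor x a) y.
Proof.
move=> ha hx.
have h : scomp (scomp mu (sthom (sid L) be)) (sassoc L A L)
    = scomp be (sthom al (sid L))
      + scomp (scomp (scomp be (sthom (sid A) mu)) (sassoc A L L))
          (sthom (sbraid L A) (sid L)).
  exact: (lrm_bracket_act M).
by rewrite /= -comp_thomr_tens h shomDE comp_thoml_tens
  (comp_thomr_braid_tens _ _ _ hx ha) andbC addrC.
Qed.

Definition superalgebra_of_monoid : LieRinehartSuperalgebra A L :=
  @Build_LieRinehartSuperalgebra K A L monoid_superalgebra
    monoid_supercommutative monoid_lieSuperalgebra monoid_superModule
    monoid_anchor monoid_anchor_bracket monoid_anchor_act monoid_bracket_act.

(** The superalgebra operations were defined as values on pure tensors, so all five equations hold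
    by conversion. *)
Lemma superalgebra_of_monoid_same : same_operations M superalgebra_of_monoid.
Proof. by []. Qed.

End MonoidToSuperalgebra.

(** * From Lie-Rinehart superalgebras to Lie-Rinehart monoids *)

Section SuperalgebraToMonoid.
Variables (K : fieldType) (A L : superSpace K).
Variable S : LieRinehartSuperalgebra A L.

Let SA := lrs_alg S.
Let SL := lrs_lie S.
Let SM := lrs_mod S.
Let rho := lrs_anchor S.

(* The even component e of 1 is a right unit: for a homogeneous, a = a 1 and
   a e is the component of a 1 of degree |a|. *)
Lemma sa_one_even : part A false (sa_one SA).
Proof.
have [ml mr] := sa_bilinear SA.
have e0 : forall a, sa_mul SA a (proj false (sa_one SA)) = a.
  apply: lin_ext1; [exact: mr|by []|move=> i a ha].
  have p0 := sa_part SA ha (proj_part false (sa_one SA)).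
  have p1 := sa_part SA ha (proj_part true (sa_one SA)).
  have := projE i ha; rewrite eqxx -{1}[a](sa_mul1r SA).
  rewrite {1}[sa_one SA]proj_sum.
  rewrite (linear_funD _ _ (ml a)) (linear_funD _ _ (@proj_linear _ _ i)).
  rewrite (projE _ p0) (projE _ p1) addbF addbT eqxx.
  by case: (i); rewrite /= addr0.
by rewrite -(e0 (sa_one SA)) sa_mul1l; apply: proj_part.
Qed.

Definition superalgebra_mul : shom (stensor A A) A :=
  slift (sa_bilinear SA) (@sa_part _ _ SA).

Definition superalgebra_bracket : shom (stensor L L) L :=
  slift (ls_bilinear SL) (@ls_part _ _ SL).

Definition superalgebra_act : shom (stensor A L) L :=
  slift (sm_bilinear SM) (@sm_part _ _ _ _ SM).

Lemma superalgebra_unit_linear :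
  linear (fun k : sunit K => (k : K) *: sa_one SA).
Proof. by move=> a x y; rewrite scalerDl scalerA. Qed.

(** The odd part of the unit object is zero, so the only content is that the unit of [A] is even. *)
Lemma superalgebra_unit_part i (k : sunit K) :
  part (sunit K) i k -> part A i ((k : K) *: sa_one SA).
Proof.
case: i => /= [->|_]; first by rewrite scale0r; apply: part0.
by apply: subspaceZ; [exact: part_subspace|exact: sa_one_even].
Qed.

Definition superalgebra_unit : shom (sunit K) A :=
  mk_shom superalgebra_unit_linear superalgebra_unit_part.

(** Membership in [sder_pred] provides two homogeneous superderivations, each linear, with sum
    [f]. *)
Lemma sder_linear (f : sder SA) : linear f.
Proof.
case: f => f /= /asboolP [f0 [f1 [[l0 _ _] [l1 _ _] ->]]] a u v.
by rewrite /= !fctE l0 l1 scalerDr addrACA.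
Qed.

Lemma superalgebra_anchor_bilinear : bilinear_map (fun x a => rho x a).
Proof.
split=> [x|a] c u v; first exact: sder_linear.
by rewrite (shom_linear rho).
Qed.

(** Since [rho] is even, [rho x] is a superderivation of degree [i], and such a map shifts degrees
    by [i]. *)
Lemma superalgebra_anchor_part i j x a :
  part L i x -> part A j a -> part A (i (+) j) (rho x a).
Proof. by move=> /(shom_part rho) [_ h _]; apply: h. Qed.

Definition superalgebra_anchor : shom (stensor L A) A :=
  slift superalgebra_anchor_bilinear superalgebra_anchor_part.

Let m := superalgebra_mul.
Let mu := superalgebra_bracket.
Let al := superalgebra_anchor.
Let be := superalgebra_act.

Lemma superalgebra_mulE a b : m (tens a b) = sa_mul SA a b.
Proof. exact: sliftE. Qed.
Lemma superalgebra_bracketE x y : mu (tens x y) = ls_bracket SL x y.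
Proof. exact: sliftE. Qed.
Lemma superalgebra_anchorE x a : al (tens x a) = rho x a.
Proof. exact: sliftE. Qed.
Lemma superalgebra_actE a x : be (tens a x) = sm_act SM a x.
Proof. exact: sliftE. Qed.

Definition superalgebra_opE := (superalgebra_mulE, superalgebra_bracketE,
  superalgebra_anchorE, superalgebra_actE).

Lemma superalgebra_comm_monoid :
  @comm_monoid_axioms K (sVec K) A superalgebra_mul superalgebra_unit.
Proof.
split.
- apply: shom_ext3l => i j k a b c _ _ _.
  rewrite (comp_thoml_tens a b c m m) (comp_thomr_tens a b c m m).
  by rewrite !superalgebra_opE sa_assoc.
- apply: shom_ext2 => i j k a _ _; rewrite slunitE scompE sthomE sliftE /=.
  have [_ mr] := sa_bilinear SA.
  by rewrite (linear_funZ _ _ (mr a)) sa_mul1l.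
- apply: shom_ext2 => i j a k _ _; rewrite srunitE scompE sthomE sliftE /=.
  have [ml _] := sa_bilinear SA.
  by rewrite (linear_funZ _ _ (ml a)) sa_mul1r.
- apply: shom_ext2 => i j a b ha hb; rewrite (comp_braid_tens m ha hb).
  by rewrite !superalgebra_opE; exact: esym (lrs_comm S ha hb).
Qed.

Lemma superalgebra_lie_monoid :
  @lie_monoid_axioms K (sVec K) L superalgebra_bracket.
Proof.
split.
- apply: shom_ext2 => i j x y hx hy.
  rewrite shomNE (comp_braid_tens mu hx hy) !superalgebra_opE.
  exact: ls_skew.
- apply: shom_ext3l => i j k x y z hx hy hz.
  rewrite shomDE (comp_thomr_tens x y z mu mu) (comp_thoml_tens x y z mu mu).
  rewrite (comp_thomr_braid_tens z mu mu hx hy) !superalgebra_opE.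
  exact: ls_jacobi hx hy hz.
Qed.

Lemma superalgebra_module :
  @module_axioms K (sVec K) A L superalgebra_mul superalgebra_unit
    superalgebra_act.
Proof.
split.
- apply: shom_ext3l => i j k a b x _ _ _.
  rewrite (comp_thoml_tens a b x be m) (comp_thomr_tens a b x be be).
  by rewrite !superalgebra_opE sm_assoc.
- apply: shom_ext2 => i j k x _ _; rewrite slunitE scompE sthomE sliftE /=.
  have [_ br] := sm_bilinear SM.
  by rewrite (linear_funZ _ _ (br x)) sm_act1.
Qed.

(** Built transparently, because [monoid_of_superalgebra_same] has to unfold its operations. *)
Definition monoid_of_superalgebra : @LieRinehartMonoid K (sVec K) A L.
Proof.
refine (@Build_LieRinehartMonoid K (sVec K) A L superalgebra_mul
  superalgebra_unit superalgebra_bracket superalgebra_anchor superalgebra_act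
  superalgebra_comm_monoid superalgebra_lie_monoid superalgebra_module _ _ _ _);
  apply: shom_ext3l => i j k x y z hx hy hz.
- rewrite shomDE (comp_thomr_tens x y z al m) (comp_thoml_tens x y z m al).
  rewrite (comp_thomr_braid_tens z m al hx hy) !superalgebra_opE.
  (* The Leibniz rule is the last clause of [rho x] being a superderivation of the degree of [x]. *)
  by case: (shom_part rho hx) => _ _ h; rewrite (h _ _ _ hy) andbC.
- rewrite (comp_thomr_tens x y z m al) (comp_thoml_tens x y z al be).
  by rewrite !superalgebra_opE; apply: lrs_anchor_act.
- rewrite shomDE (comp_thomr_tens x y z al al) (comp_thoml_tens x y z al mu).
  rewrite (comp_thomr_braid_tens z al al hx hy) !superalgebra_opE.
  (* Adding the signed reverse composite back to the supercommutator restores the iterated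
     anchor. *)
  by rewrite /rho /SL (lrs_anchor_bracket S z hx hy) subrK.
- rewrite shomDE (comp_thomr_tens x y z mu be) (comp_thoml_tens x y z be al).
  rewrite (comp_thomr_braid_tens z be mu hx hy) !superalgebra_opE.
  by rewrite /SM /SL (lrs_bracket_act S z hy hx) andbC addrC.
Defined.

Lemma monoid_of_superalgebra_same : same_operations monoid_of_superalgebra S.
Proof.
split=> [a b||x y|x a|a x]; [exact: sliftE| |exact: sliftE..].
exact: scale1r.
Qed.

End SuperalgebraToMonoid.

(** * Structures determined by their operations *)

Section Uniqueness.
Variables (K : fieldType) (A L : superSpace K).

(** Even maps out of a tensor product are determined by their values on pure tensors, and the axioms
    are proof-irrelevant. *)
Lemma same_operations_monoid_unique
    (M M' : @LieRinehartMonoid K (sVec K) A L) S :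
  same_operations M S -> same_operations M' S -> M = M'.
Proof.
case: M => m eta mu al be p1 p2 p3 p4 p5 p6 p7.
case: M' => m' eta' mu' al' be' q1 q2 q3 q4 q5 q6 q7.
move=> [/= hm he hb ha hc] [/= hm' he' hb' ha' hc'].
have em : m = m' by apply: shom_ext2 => i j x y _ _; rewrite hm hm'.
have eb : mu = mu' by apply: shom_ext2 => i j x y _ _; rewrite hb hb'.
have ea : al = al' by apply: shom_ext2 => i j x y _ _; rewrite ha ha'.
have ec : be = be' by apply: shom_ext2 => i j x y _ _; rewrite hc hc'.
have ee : eta = eta'.
  (* Every scalar is a multiple of 1, so a map out of the unit object is determined by its value
     there. *)
  apply: shomP => k; have -> : k = (k : K) *: (1 : sunit K).
    by rewrite /GRing.scale /= mulr1.
  by rewrite !shomZ he he'.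
subst; f_equal; exact: Prop_irrelevance.
Qed.

Lemma same_operations_superalgebra_unique
    (M : @LieRinehartMonoid K (sVec K) A L) S S' :
  same_operations M S -> same_operations M S' -> S = S'.
Proof.
case: S => [[m e p1 p2 p3 p4 p5] p6 [mu p7 p8 p9 p10] [be p11 p12 p13 p14] al].
move=> p15 p16 p17.
case: S' => [[m' e' q1 q2 q3 q4 q5] q6 [mu' q7 q8 q9 q10]].
move=> [be' q11 q12 q13 q14] al' q15 q16 q17.
move=> [/= hm he hb ha hc] [/= hm' he' hb' ha' hc'].
have em : m = m' by apply: funext => x; apply: funext => y; rewrite -hm hm'.
have eb : mu = mu' by apply: funext => x; apply: funext => y; rewrite -hb hb'.
have ec : be = be' by apply: funext => x; apply: funext => y; rewrite -hc hc'.
have ee : e = e' by rewrite -he he'.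
clear he he'.
subst m' mu' be' e'.
(* The two anchors land in [sDer] of two different records; the proofs inside the superalgebras must
   be identified before [al = al'] can be stated. *)
have [? ? ?] : [/\ p1 = q1, p2 = q2 & p3 = q3].
  by split; exact: Prop_irrelevance.
have [? ?] : p4 = q4 /\ p5 = q5 by split; exact: Prop_irrelevance.
subst q1 q2 q3 q4 q5.
have ea : al = al'.
  apply: shomP => x; apply: val_inj; apply: funext => a /=.
  by rewrite -ha ha'.
subst al'.
have [? ? ?] : [/\ p7 = q7, p8 = q8 & p9 = q9].
  by split; exact: Prop_irrelevance.
have [? ? ?] : [/\ p10 = q10, p11 = q11 & p12 = q12].
  by split; exact: Prop_irrelevance.
have [? ?] : p13 = q13 /\ p14 = q14 by split; exact: Prop_irrelevance.
subst q7 q8 q9 q10 q11 q12 q13 q14.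
f_equal; exact: Prop_irrelevance.
Qed.

End Uniqueness.

(** The clause on operations rules out an arbitrary bijection between the two types of
    structures. *)
Theorem lemma4p4 (R : realType) (A L : superSpace R[i]) :
  exists Phi : @LieRinehartMonoid R[i] (sVec R[i]) A L ->
               @LieRinehartSuperalgebra R[i] A L,
    bijective Phi /\
    forall M : @LieRinehartMonoid R[i] (sVec R[i]) A L,
      same_operations M (Phi M).
Proof.
exists (@superalgebra_of_monoid _ A L); split; last first.
  exact: superalgebra_of_monoid_same.
(* In each round trip the initial and final structures share their operations with the intermediate
   one, so uniqueness identifies them. *)
exists (@monoid_of_superalgebra _ A L) => [M|S].
- exact: same_operations_monoid_unique (monoid_of_superalgebra_same _)
    (superalgebra_of_monoid_same M).
- exact: same_operations_superalgebra_unique (superalgebra_of_monoid_same _)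
    (monoid_of_superalgebra_same S).
Qed.
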